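(* (i) An integer $n>1$ with at most two distinct prime divisors is a primitive covering number if and only if $n=2^{p-1}p$ for some odd prime $p$. (ii) A positive integer $n\equiv 0\pmod 3$ with exactly three distinct prime divisors is a primitive covering number if and only if $n=2\cdot 3^{(p-1)/2}p$ for some prime $p>3$. (iii) If $p>5$ is a prime, then both $2^3 5^{\lfloor (p-1)/4\rfloor}p$ and $2\cdot 3\cdot 5^{\lfloor (p-1)/4\rfloor}p$ are primitive covering numbers. If $p>7$ is a prime, then $2\cdot 3^2\, 7^{\lfloor (p-1)/6\rfloor}p$ is a primitive covering number, and so is $2^5 7^{\lfloor (p-1)/6\rfloor}p$ provided that $p\neq 13,19$.
   Context: For $a\in\mathbb{Z}$ and a positive integer $n$, $a(\mathrm{mod}\ n)=\{a+nx: x\in\mathbb{Z}\}$ is the residue class with modulus $n$. A finite system of residue classes $\{a_i(\mathrm{mod}\ n_i)\}_{i=1}^k$ is a cover of $\mathbb{Z}$ if every integer lies in at least one of the classes $a_i(\mathrm{mod}\ n_i)$. A positive integer $n$ is called a covering number if there is a cover of $\mathbb{Z}$ whose moduli are all distinct, greater than one, and divisors of $n$. A covering number is called a primitive covering number if none of its proper divisors (positive divisors smaller than the number itself) is a covering number. $\lfloor x\rfloor$ denotes the greatest integer not exceeding $x$. *)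

(* Defs.v *)
From mathcomp Require Import all_boot all_order all_algebra.

Set Implicit Arguments.
Unset Strict Implicit.
Unset Printing Implicit Defensive.

Local Open Scope nat_scope.

Definition residue_class (a : int) (n : nat) (z : int) : Prop :=
  exists x : int, z = (a + n%:Z * x)%R.

(* The pair [(a, n)] stands for the residue class a (mod n). *)
Definition residue_system := seq (int * nat).

Definition is_cover (s : residue_system) : Prop :=
  all (fun c => 0 < c.2) s /\
  forall z : int, exists2 c, c \in s & residue_class c.1 c.2 z.

Definition covering_number (n : nat) : Prop :=
  0 < n /\
  exists s : residue_system,
    [/\ is_cover s,
        uniq [seq c.2 | c <- s],
        all (fun c => 1 < c.2) s &
        all (fun c => c.2 %| n) s].

Definition primitive_covering_number (n : nat) : Prop :=
  covering_number n /\
  forall d : nat, d %| n -> d < n -> ~ covering_number d.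

(* Main.v *)
(* Necessity: if n = p^v m is primitive, some z0 escapes every class whose modulus
   divides n / p, and the p integers z0 + j n / p must lie in classes whose moduli
   p^v e, e | m, are distinct; so p is at most the number tau(m) of divisors of m.
   Sufficiency: classes can be chosen greedily, one prime at a time, so that only
   the multiples of m remain uncovered; the tau(m) moduli d p^(a+1), d | m, then
   dispose of all but one of the p subclasses (of all of them if tau(m) >= p).
   A density count shows that 2 divides every covering number with at most three
   prime factors.  What remains is a comparison of exponents: every primitive
   divisor of one of the listed numbers is that number itself. *)
Require Import Defs.
From Stdlib Require Import Classical.
From mathcomp Require Import all_boot all_order all_algebra.
From mathcomp Require Import zify.

Set Implicit Arguments.
Unset Strict Implicit.
Unset Printing Implicit Defensive.

Import GRing.Theory Num.Theory.

Local Open Scope nat_scope.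

(** * Divisors and residue systems *)

(** Take [d1 = gcdn d m]: the cofactors of [d] and [m] are then coprime, so by Gauss's lemma
    [d %/ d1] divides [n]. *)
Lemma dvdn_mul_split d m n : 0 < m -> d %| m * n ->
  exists d1 d2, [/\ d1 %| m, d2 %| n & d = d1 * d2].
Proof.
move=> m_gt0 dmn; have g_gt0 : 0 < gcdn d m by rewrite gcdn_gt0 m_gt0 orbT.
exists (gcdn d m), (d %/ gcdn d m); split; first exact: dvdn_gcdr.
  have co : coprime (d %/ gcdn d m) (m %/ gcdn d m).
    rewrite /coprime -(eqn_pmul2r g_gt0) muln_gcdl !divnK ?dvdn_gcdl ?dvdn_gcdr //.
    by rewrite mul1n.
  rewrite -(Gauss_dvdr _ co) -(dvdn_pmul2r g_gt0) mulnAC.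
  by rewrite !divnK ?dvdn_gcdl ?dvdn_gcdr.
by rewrite mulnC divnK ?dvdn_gcdl.
Qed.

Lemma dvdn_pfactorM p a m d : prime p -> d %| p ^ a * m ->
  exists x d', [/\ x <= a, d' %| m & d = p ^ x * d'].
Proof.
move=> pp; case/dvdn_mul_split=> [|d1 [d2 [+ d2m ->]]]; first by rewrite expn_gt0 prime_gt0.
by case/(dvdn_pfactor _ _ pp)=> x xa ->; exists x, d2.
Qed.

Definition tau n := size (divisors n).

Lemma tau_pfactor p a : prime p -> tau (p ^ a) = a.+1.
Proof.
move=> pp; have pa0 : 0 < p ^ a by rewrite expn_gt0 prime_gt0.
have -> : a.+1 = size [seq p ^ i | i <- iota 0 a.+1] by rewrite size_map size_iota.
apply/perm_size/uniq_perm; first exact: divisors_uniq.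
  rewrite map_inj_uniq ?iota_uniq // => i j /eqP.
  by rewrite eqn_exp2l ?prime_gt1 // => /eqP.
move=> d; rewrite -dvdn_divisors //; apply/dvdn_pfactor/mapP => //.
  by case=> i le_ia ->; exists i; rewrite // mem_iota add0n ltnS.
by case=> i; rewrite mem_iota add0n ltnS => le_ia ->; exists i.
Qed.

Lemma tauM m n : coprime m n -> 0 < m -> 0 < n -> tau (m * n) = tau m * tau n.
Proof.
move=> co_mn m_gt0 n_gt0; rewrite /tau -(size_allpairs muln).
apply/perm_size/uniq_perm; first exact: divisors_uniq.
  apply: allpairs_uniq; try exact: divisors_uniq.
  have gcdE d e : d %| m -> e %| n -> gcdn (d * e) m = d /\ gcdn (d * e) n = e.
    move=> dm en; rewrite 2!(gcdnC (d * e)) Gauss_gcdl ?(coprime_dvdr en) //.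
    rewrite Gauss_gcdr; last by rewrite coprime_sym; apply: coprime_dvdl dm _.
    by split; apply/gcdn_idPr.
  move=> [d e] [d' e'] /allpairsP[[a b] [/= am bn [-> ->]]].
  case/allpairsP=> -[a' b'] [/= am' bn' [-> ->]].
  move: am bn am' bn'; rewrite -!dvdn_divisors // => am bn am' bn' eq_ab.
  have [ea eb] := gcdE _ _ am bn; have [ea' eb'] := gcdE _ _ am' bn'.
  by congr (_, _); [rewrite -[LHS]ea eq_ab ea' | rewrite -[LHS]eb eq_ab eb'].
move=> d; rewrite -dvdn_divisors ?muln_gt0 ?m_gt0 //; apply/idP/allpairsP.
  case/dvdn_mul_split=> // d1 [d2 [d1m d2n ->]].
  by exists (d1, d2); rewrite /= -!dvdn_divisors.
by case=> -[d1 d2] /=; rewrite -!dvdn_divisors // => -[d1m d2n ->]; apply: dvdn_mul.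
Qed.

(* The residue attached to the modulus [d] is [f d]; encoding a system as a
   function of the modulus makes the distinctness of the moduli automatic. *)
Definition covered (f : nat -> nat) (n z : nat) : Prop :=
  exists d, [/\ 1 < d, d %| n & z = f d %[mod d]].

Lemma covering_numberP n :
  covering_number n <-> 0 < n /\ exists f, forall z, covered f n z.
Proof.
split=> [[n_gt0 [s [[_ cov_s] uniq_s /allP gt1_s /allP dvd_s]]] | [n_gt0 [f cov_f]]].
  split=> //; pose c0 : int * nat := (0%R, 1).
  (* Distinct moduli make the class of modulus [d] unique; its residue is reduced to a natural
     number. A modulus that does not occur gets the default residue 0. *)
  exists (fun d => `|((nth c0 s (index d [seq c.2 | c <- s])).1 %% d)%Z|) => z.
  have [c cs [x zE]] := cov_s z; exists c.2; split; [exact: gt1_s | exact: dvd_s | ].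
  case/(nthP c0): (cs) => i lt_is cE.
  have -> : index c.2 [seq c.2 | c <- s] = i.
    by rewrite -cE -(nth_map _ 0) // index_uniq ?size_map.
  have c_gt0 : 0 < c.2 by apply: dvdn_gt0 (dvd_s _ cs).
  rewrite cE; apply: (can_inj absz_nat); rewrite -!modz_nat gez0_abs ?modz_ge0 //; last by lia.
  by rewrite modz_mod zE mulrC addrC modzMDl.
split=> //; exists [seq (Posz (f d), d) | d <- divisors n & 1 < d].
have gt1P c : c \in [seq (Posz (f d), d) | d <- divisors n & 1 < d] -> 1 < c.2 /\ c.2 %| n.
  by case/mapP=> d; rewrite mem_filter -dvdn_divisors // => /andP[d1 dn] ->.
split; first split.
- by apply/allP=> c /gt1P[/ltnW].
(* Every modulus divides [n], so an integer may be replaced by its remainder modulo [n]. *)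
- move=> z; have [d [d1 dn dE]] := cov_f `|(z %% n)%Z|.
  exists (Posz (f d), d) => /=.
    by apply: map_f; rewrite mem_filter d1 -dvdn_divisors.
  suff /eqP : (z = f d %[mod d])%Z.
    by rewrite eqz_mod_dvd => /dvdzP[x zE]; exists x; rewrite mulrC -zE addrC subrK.
  have r_ge0 : (0 <= z %% n)%Z%R by rewrite modz_ge0 //; lia.
  rewrite [in LHS](divz_eq z n) -(gez0_abs r_ge0); move: dE; set r := `|_| => dE.
  by rewrite -{2}(divnK dn) PoszM mulrA modzMDl !modz_nat dE.
- rewrite -map_comp map_id_in ?filter_uniq ?divisors_uniq //.
- by apply/allP=> c /gt1P[].
by apply/allP=> c /gt1P[].
Qed.

(** * Construction of covers, and the divisor bound for primitive numbers *)

(** The invariant of the greedy construction: at most the single class 0 (mod [N]) is left to later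
    moduli. *)
Definition covers_nonmultiples N := exists f, forall z, ~~ (N %| z) -> covered f N z.

Lemma covers_nonmultiples1 : covers_nonmultiples 1.
Proof. by exists id => z; rewrite dvd1n. Qed.

(* The [j]-th modulus of [ds] receives the residue [N * j], counted from 1. *)
Lemma covered_extend N p ds : 0 < N * p -> uniq ds ->
  {in ds, forall d, d %| N * p /\ ~~ (d %| N)} -> covers_nonmultiples N ->
  exists g, forall z,
    ~~ (N %| z) \/ (exists2 j, 0 < j <= size ds & z = N * j %[mod N * p]) ->
    covered g (N * p) z.
Proof.
move=> Np_gt0 uniq_ds ds_dvd [f cov_f].
exists (fun d => if d \in ds then N * (index d ds).+1 else f d) => z.
case=> [/cov_f[d [d1 dN zE]] | [[//|j] lt_j zE]].
  exists d; split; rewrite ?dvdn_mulr //; case: ifP => // /ds_dvd[_].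
  by rewrite dN.
have ds_j : nth 0 ds j \in ds by apply: mem_nth.
have [dNp dN] := ds_dvd _ ds_j; exists (nth 0 ds j); split=> //.
  rewrite ltn_neqAle (dvdn_gt0 Np_gt0 dNp) andbT eq_sym.
  by apply: contraNneq dN => ->; rewrite dvd1n.
by rewrite ds_j index_uniq // -(modn_dvdm z dNp) zE modn_dvdm.
Qed.

Section Extend.
Variables (m p a : nat) (ds : seq nat).
Hypotheses (p_pr : prime p) (m_gt0 : 0 < m) (co_pm : coprime p m).
Hypothesis (cov_m : covers_nonmultiples (m * p ^ a)).

(** These are the divisors of [m * p ^ a.+1] in which [p] has its full exponent, one for each
    divisor of [m]. *)
Lemma new_moduli : exists ds, [/\ size ds = tau m, uniq ds &
  {in ds, forall d, d %| m * p ^ a * p /\ ~~ (d %| m * p ^ a)}].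
Proof.
have p_gt1 := prime_gt1 p_pr.
exists [seq d * p ^ a.+1 | d <- divisors m]; split; first by rewrite size_map.
  rewrite map_inj_uniq ?divisors_uniq // => d e /eqP.
  by rewrite eqn_pmul2r ?expn_gt0 ?prime_gt0 // => /eqP.
move=> _ /mapP[d + ->]; rewrite -dvdn_divisors // => dm; split.
  by rewrite -mulnA -expnSr dvdn_mul.
apply/negP=> /(dvdn_trans (dvdn_mull d (dvdnn _))).
by rewrite Gauss_dvdr ?coprimeXl // dvdn_Pexp2l // ltnn.
Qed.

(** The multiples of [N = m * p ^ a] form [p] classes modulo [N * p]. One of them consists of the
    multiples of [N * p] and may stay uncovered, so [p.-1] new moduli suffice. *)
Lemma covers_nonmultiples_step : p.-1 <= tau m -> covers_nonmultiples (m * p ^ a.+1).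
Proof.
have p_gt0 := prime_gt0 p_pr => le_p.
have [es [size_es uniq_es es_dvd]] := new_moduli; rewrite expnSr mulnA.
have Np_gt0 : 0 < m * p ^ a * p by rewrite !muln_gt0 m_gt0 expn_gt0 p_gt0.
have [g cov_g] := covered_extend Np_gt0 uniq_es es_dvd cov_m.
exists g => z nz; apply: cov_g; case: (boolP (_ %| z)) => [|]; last by left.
case/dvdnP=> t zE; right; exists (t %% p); last first.
  by rewrite zE mulnC -!muln_modr modn_mod.
have := ltn_pmod t p_gt0; rewrite lt0n -/(dvdn _ _) size_es.
suff -> : t %% p != 0 by lia.
by apply: contra nz; rewrite zE mulnC dvdn_pmul2r // muln_gt0 m_gt0 expn_gt0 p_gt0.
Qed.
End Extend.

Lemma covers_nonmultiples_pfactor m p a : prime p -> 0 < m -> coprime p m ->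
  p.-1 <= tau m -> covers_nonmultiples m -> covers_nonmultiples (m * p ^ a).
Proof.
move=> p_pr m_gt0 co_pm le_p cov_m; elim: a => [|a IHa]; first by rewrite muln1.
exact: covers_nonmultiples_step.
Qed.

(** Here nothing may stay uncovered: each of the [p] subclasses takes a modulus of its own, which
    raises the bound from [p.-1] to [p]. *)
Lemma covering_number_last_prime m p : prime p -> 0 < m -> coprime p m ->
  p <= tau m -> covers_nonmultiples m -> covering_number (m * p).
Proof.
move=> p_pr m_gt0 co_pm le_p cov_m; have p_gt0 := prime_gt0 p_pr.
have [es [size_es uniq_es es_dvd]] := new_moduli 0 p_pr m_gt0 co_pm.
rewrite muln1 in es_dvd; have Np_gt0 : 0 < m * p by rewrite muln_gt0 m_gt0.
have [g cov_g] := covered_extend Np_gt0 uniq_es es_dvd cov_m.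
apply/covering_numberP; split=> //; exists g => z; apply: cov_g.
case: (boolP (m %| z)) => [|]; last by left.
case/dvdnP=> t ->; right; rewrite size_es; case: (posnP (t %% p)) => t0.
  (* Positions are counted from 1, so the residue 0 takes position [p]. *)
  by exists p; [lia | rewrite mulnC -!muln_modr t0 modnn].
exists (t %% p); last by rewrite mulnC -!muln_modr modn_mod.
by have := ltn_pmod t p_gt0; lia.
Qed.

Lemma not_covering_number1 : ~ covering_number 1.
Proof. by case/covering_numberP=> _ [f /(_ 0)[d [d1 /dvdn_leq]]]; lia. Qed.

Lemma primitive_divisor n : covering_number n ->
  exists2 d, d %| n & primitive_covering_number d.
Proof.
elim/ltn_ind: n => n IHn cov_n.
have [prim_n | ] := classic (primitive_covering_number n); first by exists n.
move=> nprim; have [d dP] : exists d, [/\ d %| n, d < n & covering_number d].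
  apply: NNPP => H; apply: nprim; split=> // d dn lt_dn cov_d.
  by apply: H; exists d.
case: dP => dn lt_dn /IHn[] // e ed prim_e.
by exists e => //; apply: dvdn_trans ed dn.
Qed.

(** Only primitive divisors have to be examined, and to these the bound of [primitive_tau]
    applies. *)
Lemma primitive_of_divisors n : covering_number n ->
  (forall d, d %| n -> primitive_covering_number d -> d = n) -> primitive_covering_number n.
Proof.
move=> cov_n prim_n; split=> // d dn lt_dn cov_d.
have [e ed prim_e] := primitive_divisor cov_d.
have := dvdn_leq (proj1 cov_d) ed.
by rewrite (prim_n e (dvdn_trans ed dn) prim_e) leqNgt lt_dn.
Qed.

Lemma primitive_tau p v m : prime p -> coprime p m -> 0 < m -> 0 < v ->
  primitive_covering_number (p ^ v * m) -> p <= tau m.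
Proof.
move=> p_pr co_pm m_gt0 v_gt0 [/covering_numberP[n_gt0 [f cov_f]] prim].
have p_gt1 := prime_gt1 p_pr; have p_gt0 := prime_gt0 p_pr.
pose n' := p ^ v.-1 * m.
have nE : p ^ v * m = p * n' by rewrite mulnA -expnS prednK.
have n'_gt0 : 0 < n' by rewrite muln_gt0 expn_gt0 p_gt0.
(* The proper divisor [n'] is not a covering number, so the residues [f] restricted to it miss some
   [z0]. *)
have /not_all_ex_not[z0 z0P] : ~ forall z, covered f n' z.
  move=> cov'; apply: (prim n'); first by rewrite nE dvdn_mull.
    by rewrite nE ltn_Pmull.
  by apply/covering_numberP; split=> //; exists f.
(* A modulus with [p]-exponent below [v] divides [n'] and would already cover [z0]; hence
   [z0 + j * n'] needs a modulus [p ^ v * e]. *)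
have /fin_all_exists[e eP] (j : 'I_p) : exists e,
    e %| m /\ z0 + j * n' = f (p ^ v * e) %[mod p ^ v * e].
  have [d [d1 + zE]] := cov_f (z0 + j * n').
  case/(dvdn_pfactorM p_pr)=> x [e [le_xv em dE]].
  have [eq_xv | neq_xv] := eqVneq x v; first by exists e; rewrite -eq_xv -dE.
  have dn' : d %| n' by rewrite dE dvdn_mul // dvdn_exp2l //; lia.
  case: z0P; exists d; split=> //; rewrite -zE -modnDmr.
  by rewrite (eqP (dvdn_mull j dn')) addn0.
(* If [i] and [j] share [e], then [p ^ v] divides [(j - i) * n']; cancelling [p ^ v.-1] and [m]
   shows that [p] divides [j - i], which is less than [p]. *)
have e_inj : injective e.
  move=> i j; wlog le_ij : i j / i <= j => [IH | eq_e].
    by case: (leqP i j) => [/IH // | /ltnW/IH IH' /esym/IH'].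
  apply/val_inj => /=; have [_ Ei] := eP i; have [_ Ej] := eP j.
  move: Ei; rewrite eq_e -Ej => /esym/eqP; rewrite eqn_modDl.
  rewrite eqn_mod_dvd ?leq_mul2r ?le_ij ?orbT // -mulnBl.
  move/(dvdn_trans (dvdn_mulr _ (dvdnn _))).
  rewrite -{1}(prednK v_gt0) expnSr mulnCA dvdn_pmul2l ?expn_gt0 ?p_gt0 //.
  rewrite Gauss_dvdl // => /dvdn_leq; have := ltn_ord j; lia.
rewrite -[leqLHS]card_ord -(size_image e); apply: uniq_leq_size.
  by rewrite map_inj_uniq ?enum_uniq.
by move=> _ /imageP[j _ ->]; rewrite -dvdn_divisors //; case: (eP j).
Qed.

(** * Odd numbers with at most three prime factors *)

Lemma leq_card_bigcup (I T : finType) (F : I -> {set T}) (u : I -> nat) :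
  (forall i, #|F i| <= u i) -> #|\bigcup_i F i| <= \sum_i u i.
Proof.
move=> le_Fu; apply: (big_ind2 (fun (A : {set T}) (n : nat) => is_true (#|A| <= n))) => //.
  by rewrite cards0.
by move=> A m B n leA leB; apply: leq_trans (leq_add leA leB); rewrite leq_card_setU.
Qed.

Definition res_class p a x c := [set i : 'I_(p ^ a) | i == c %[mod p ^ x]].

Lemma card_res_class p a x c : 0 < p -> x <= a -> #|res_class p a x c| <= p ^ (a - x).
Proof.
move=> p_gt0 le_xa; have px_gt0 : 0 < p ^ x by rewrite expn_gt0 p_gt0.
have lt_div (i : 'I_(p ^ a)) : i %/ p ^ x < p ^ (a - x).
  by rewrite ltn_divLR // -expnD subnK.
pose h i : 'I_(p ^ (a - x)) := Ordinal (lt_div i).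
rewrite -(@card_in_imset _ _ h); first by rewrite -[leqRHS]card_ord max_card.
move=> i j; rewrite !inE => /eqP Ei /eqP Ej [Eh]; apply/val_inj => /=.
by rewrite (divn_eq i (p ^ x)) Eh Ei -Ej -divn_eq.
Qed.

(** This is 1 + p + ... + p^(a-1), ordered so that the term of index [x] bounds the size of a class
    modulo [p ^ x.+1]. *)
Definition geom p a := \sum_(x < a) p ^ (a - x.+1).

Lemma geom_lt p a : 0 < p -> p.-1 * geom p a < p ^ a.
Proof.
move=> p_gt0; have -> : geom p a = \sum_(x < a) p ^ x.
  by rewrite [RHS](reindex_inj rev_ord_inj).
by rewrite -predn_exp prednK // expn_gt0 p_gt0.
Qed.

Definition avoiding p a (c : nat -> nat) := ~: \bigcup_(x < a) res_class p a x.+1 (c x.+1).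

Lemma card_avoiding p a c : 0 < p -> p ^ a <= #|avoiding p a c| + geom p a.
Proof.
move=> p_gt0; rewrite -[leqLHS](card_ord (p ^ a)) -(cardsC (avoiding p a c)) leq_add2l setCK.
by apply: leq_card_bigcup => x; apply: card_res_class.
Qed.

Lemma avoidingP p a c (i : 'I_(p ^ a)) x :
  i \in avoiding p a c -> 0 < x <= a -> i != c x %[mod p ^ x].
Proof.
case: x => // x + lt_xa; rewrite inE; apply: contra => eq_i.
by apply/bigcupP; exists (Ordinal lt_xa); rewrite ?inE.
Qed.

Section Count.
Variables (p q r a b c : nat) (g : nat -> nat -> nat -> nat).
Hypotheses (p_gt0 : 0 < p) (q_gt0 : 0 < q) (r_gt0 : 0 < r).
Hypothesis cover_g : forall (i : 'I_(p ^ a)) (j : 'I_(q ^ b)) (k : 'I_(r ^ c)),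
  exists x y z, [/\ x <= a /\ y <= b /\ z <= c, 0 < x + y + z,
    i == g x y z %[mod p ^ x], j == g x y z %[mod q ^ y] & k == g x y z %[mod r ^ z]].

Let box x y z := setX (setX (res_class p a x (g x y z)) (res_class q b y (g x y z)))
                      (res_class r c z (g x y z)).

Let card_box x y z : x <= a -> y <= b -> z <= c ->
  #|box x y z| <= p ^ (a - x) * q ^ (b - y) * r ^ (c - z).
Proof. by move=> xa yb zc; rewrite !cardsX !leq_mul ?card_res_class. Qed.

(** A triple of avoiding residues escapes all moduli that are powers of one prime, so it lies in a
    box with at least two positive exponents. The right side bounds the total size of these boxes,
    grouped by which exponents are positive. *)
Lemma avoiding_count :
  #|avoiding p a (fun x => g x 0 0)| * #|avoiding q b (fun y => g 0 y 0)| *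
  #|avoiding r c (fun z => g 0 0 z)| <=
  geom p a * geom q b * r ^ c + geom p a * q ^ b * geom r c +
  p ^ a * geom q b * geom r c + geom p a * geom q b * geom r c.
Proof.
rewrite -!cardsX.
pose M1 := \bigcup_(x < a) \bigcup_(y < b) box x.+1 y.+1 0.
pose M2 := \bigcup_(x < a) \bigcup_(z < c) box x.+1 0 z.+1.
pose M3 := \bigcup_(y < b) \bigcup_(z < c) box 0 y.+1 z.+1.
pose M4 := \bigcup_(x < a) \bigcup_(y < b) \bigcup_(z < c) box x.+1 y.+1 z.+1.
have M1_le : #|M1| <= geom p a * geom q b * r ^ c.
  rewrite [geom p a * _]big_distrlr /= big_distrl /=; apply: leq_card_bigcup => x.
  rewrite big_distrl /=; apply: leq_card_bigcup => y.
  by have := @card_box x.+1 y.+1 0; rewrite subn0; apply.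
have M2_le : #|M2| <= geom p a * q ^ b * geom r c.
  rewrite mulnAC [geom p a * _]big_distrlr /= big_distrl /=; apply: leq_card_bigcup => x.
  rewrite big_distrl /=; apply: leq_card_bigcup => z.
  by rewrite mulnAC; have := @card_box x.+1 0 z.+1; rewrite subn0; apply.
have M3_le : #|M3| <= p ^ a * geom q b * geom r c.
  rewrite -mulnA big_distrlr /= big_distrr /=; apply: leq_card_bigcup => y.
  rewrite big_distrr /=; apply: leq_card_bigcup => z.
  by rewrite mulnA; have := @card_box 0 y.+1 z.+1; rewrite subn0; apply.
have M4_le : #|M4| <= geom p a * geom q b * geom r c.
  rewrite -mulnA big_distrl /=; apply: leq_card_bigcup => x.
  rewrite big_distrlr /= big_distrr /=; apply: leq_card_bigcup => y.
  rewrite big_distrr /=; apply: leq_card_bigcup => z.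
  by rewrite mulnA card_box.
apply: leq_trans (leq_add (leq_add (leq_add M1_le M2_le) M3_le) M4_le).
apply: (@leq_trans #|M1 :|: M2 :|: M3 :|: M4|); last first.
  apply: leq_trans (leq_card_setU _ _) _; rewrite leq_add2r.
  apply: leq_trans (leq_card_setU _ _) _; rewrite leq_add2r.
  exact: leq_card_setU.
apply/subset_leq_card/subsetP=> -[[i j] k] /setXP[/setXP[/= Ui Uj] Uk].
have [x [y [z [[xa [yb zc]] xyz_gt0 Ei Ej Ek]]]] := cover_g i j k.
have in_box : (i, j, k) \in box x y z by rewrite !inE /= Ei Ej Ek.
(* The all-zero pattern is excluded, the three patterns with one positive exponent contradict
   avoidance, and the other four land in [M1] to [M4]. *)
case: x y z xa yb zc xyz_gt0 Ei Ej Ek in_box => [|x] [|y] [|z] xa yb zc // _ Ei Ej Ek in_box.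
- by rewrite (negPf (avoidingP Uk _)) in Ek.
- by rewrite (negPf (avoidingP Uj _)) in Ej.
- suff in_M : (i, j, k) \in M3 by rewrite !in_setU in_M !orbT.
  by apply/bigcupP; exists (Ordinal yb) => //; apply/bigcupP; exists (Ordinal zc).
- by rewrite (negPf (avoidingP Ui _)) in Ei.
- suff in_M : (i, j, k) \in M2 by rewrite !in_setU in_M !orbT.
  by apply/bigcupP; exists (Ordinal xa) => //; apply/bigcupP; exists (Ordinal zc).
- suff in_M : (i, j, k) \in M1 by rewrite !in_setU in_M.
  by apply/bigcupP; exists (Ordinal xa) => //; apply/bigcupP; exists (Ordinal yb).
suff in_M : (i, j, k) \in M4 by rewrite !in_setU in_M !orbT.
apply/bigcupP; exists (Ordinal xa) => //; apply/bigcupP; exists (Ordinal yb) => //.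
by apply/bigcupP; exists (Ordinal zc).
Qed.
End Count.

(* With [s / P < 1/2], [t / Q < 1/4] and [u / R < 1/6] the mixed classes have
   density below 13/48, while at least 15/48 is missed by the pure ones. *)
Lemma avoiding_arith P Q R s t u A B C :
  2 * s < P -> 4 * t < Q -> 6 * u < R -> P <= A + s -> Q <= B + t -> R <= C + u ->
  s * t * R + s * Q * u + P * t * u + s * t * u < A * B * C.
Proof.
move=> lt_s lt_t lt_u leA leB leC.
have : (P - s) * (Q - t) * (R - u) <= A * B * C by rewrite !leq_mul //; lia.
apply: leq_trans.
(* Slack variables remove the truncated subtractions. After expansion every coefficient on the left
   is at most the matching one on the right, which also has a constant term 1. *)
have [x ->] : exists x, P = 2 * s + 1 + x by exists (P - (2 * s + 1)); lia.
have [y ->] : exists y, Q = 4 * t + 1 + y by exists (Q - (4 * t + 1)); lia.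
have [z ->] : exists z, R = 6 * u + 1 + z by exists (R - (6 * u + 1)); lia.
have -> : 2 * s + 1 + x - s = s + 1 + x by lia.
have -> : 4 * t + 1 + y - t = 3 * t + 1 + y by lia.
have -> : 6 * u + 1 + z - u = 5 * u + 1 + z by lia.
nia.
Qed.

Lemma eqmod_dvdn d e m n : d %| e -> m = n %[mod e] -> m = n %[mod d].
Proof. by move=> de E; rewrite -(modn_dvdm m de) E modn_dvdm. Qed.

(** The Chinese remainder theorem turns a cover into a covering of a three-dimensional grid, where
    [avoiding_count] contradicts [avoiding_arith]. Exponents may be 0, so fewer odd primes are
    included. *)
Lemma three_odd_primes_not_covering p q r a b c :
  prime p -> prime q -> prime r -> 2 < p -> p < q -> q < r ->
  ~ covering_number (p ^ a * (q ^ b * r ^ c)).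
Proof.
move=> p_pr q_pr r_pr p_gt2 lt_pq lt_qr /covering_numberP[_ [f cov_f]].
have p_gt0 : 0 < p by lia.
have q_gt0 : 0 < q by lia.
have r_gt0 : 0 < r by lia.
have co x y : prime x -> prime y -> x < y -> coprime x y.
  by move=> xp yp xy; rewrite prime_coprime // dvdn_prime2 //; lia.
have co_qr : coprime (q ^ b) (r ^ c) by rewrite coprimeXl ?coprimeXr ?co.
have co_p : coprime (p ^ a) (q ^ b * r ^ c).
  by rewrite coprimeMr !coprimeXl ?coprimeXr ?co //; lia.
pose g x y z := f (p ^ x * (q ^ y * r ^ z)).
have cover_g (i : 'I_(p ^ a)) (j : 'I_(q ^ b)) (k : 'I_(r ^ c)) :
  exists x y z, [/\ x <= a /\ y <= b /\ z <= c, 0 < x + y + z,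
    i == g x y z %[mod p ^ x], j == g x y z %[mod q ^ y] & k == g x y z %[mod r ^ z]].
  pose w := chinese (q ^ b) (r ^ c) j k.
  pose n := chinese (p ^ a) (q ^ b * r ^ c) i w.
  have [d [d_gt1 + nE]] := cov_f n.
  case/(dvdn_pfactorM p_pr)=> x [d1 [xa /(dvdn_pfactorM q_pr)[y [d2 [yb]]]]].
  case/(dvdn_pfactor _ _ r_pr)=> z zc -> -> dE.
  have nP : n = i %[mod p ^ a] by rewrite chinese_modl.
  have nW : n = w %[mod q ^ b * r ^ c] by rewrite chinese_modr.
  have nQ : n = j %[mod q ^ b].
    by rewrite (eqmod_dvdn (dvdn_mulr _ (dvdnn _)) nW) chinese_modl.
  have nR : n = k %[mod r ^ c].
    by rewrite (eqmod_dvdn (dvdn_mull _ (dvdnn _)) nW) chinese_modr.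
  exists x, y, z; rewrite /g -dE; split=> //.
  - by case: x y z {xa yb zc} dE => [|x] [|y] [|z] // dE; rewrite dE in d_gt1.
  - rewrite -(eqmod_dvdn (dvdn_exp2l p xa) nP); apply/eqP/(eqmod_dvdn _ nE).
    by rewrite dE dvdn_mulr.
  - rewrite -(eqmod_dvdn (dvdn_exp2l q yb) nQ); apply/eqP/(eqmod_dvdn _ nE).
    by rewrite dE dvdn_mull ?dvdn_mulr.
  rewrite -(eqmod_dvdn (dvdn_exp2l r zc) nR); apply/eqP/(eqmod_dvdn _ nE).
  by rewrite dE !dvdn_mull.
have odd_gt2 x : prime x -> 2 < x -> odd x by move=> /even_prime[->|].
have odd_p := odd_gt2 p p_pr p_gt2.
have odd_q : odd q by apply: odd_gt2; lia.
have odd_r : odd r by apply: odd_gt2; lia.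
(* Odd and increasing, the primes are at least 3, 5 and 7, whence the constants 2, 4 and 6. *)
have bound s e m : 0 < s -> m < s -> m * geom s e < s ^ e.
  move=> s_gt0 lt_ms; apply: leq_ltn_trans (geom_lt e s_gt0).
  by rewrite leq_mul2r; lia.
have := avoiding_count p_gt0 q_gt0 r_gt0 cover_g; apply/negP; rewrite -ltnNge.
apply: avoiding_arith; try exact: card_avoiding; apply: bound; lia.
Qed.

(** * Comparison of exponents *)

Lemma coprime_ltn_primes p q a b : prime p -> prime q -> p < q ->
  coprime (p ^ a) (q ^ b).
Proof.
move=> p_pr q_pr lt_pq; rewrite coprimeXl ?coprimeXr //.
by rewrite prime_coprime // dvdn_prime2 // neq_ltn lt_pq.
Qed.

Lemma tau2 p q a b : prime p -> prime q -> p < q ->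
  tau (p ^ a * q ^ b) = a.+1 * b.+1.
Proof.
move=> p_pr q_pr lt_pq; rewrite tauM ?coprime_ltn_primes ?expn_gt0 ?prime_gt0 //.
by rewrite !tau_pfactor.
Qed.

Lemma coprime3 p q r a b c : prime p -> prime q -> prime r -> p < q -> q < r ->
  coprime (p ^ a * q ^ b) (r ^ c).
Proof.
by move=> p_pr q_pr r_pr pq qr; rewrite coprimeMl !coprime_ltn_primes ?(ltn_trans pq).
Qed.

Lemma tau3 p q r a b c : prime p -> prime q -> prime r -> p < q -> q < r ->
  tau (p ^ a * q ^ b * r ^ c) = a.+1 * b.+1 * c.+1.
Proof.
move=> p_pr q_pr r_pr pq qr.
by rewrite tauM ?coprime3 ?muln_gt0 ?expn_gt0 ?prime_gt0 // tau2 ?tau_pfactor.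
Qed.

(** The last three implications are what [primitive_tau] gives for a primitive divisor with
    exponents [x], [y], [z]; primitivity becomes arithmetic on exponents. *)
Lemma primitive_of_exponents3 p q r a b c :
  prime p -> prime q -> prime r -> p < q -> q < r ->
  covering_number (p ^ a * q ^ b * r ^ c) ->
  (forall x y z, x <= a -> y <= b -> z <= c -> 0 < x + y + z ->
     (0 < x -> p <= y.+1 * z.+1) -> (0 < y -> q <= x.+1 * z.+1) ->
     (0 < z -> r <= x.+1 * y.+1) -> [/\ x = a, y = b & z = c]) ->
  primitive_covering_number (p ^ a * q ^ b * r ^ c).
Proof.
move=> p_pr q_pr r_pr pq qr cov abcP; have pr := ltn_trans pq qr.
apply: primitive_of_divisors cov _ => d.
rewrite -mulnA => /(dvdn_pfactorM p_pr)[x [d1 [xa /(dvdn_pfactorM q_pr)[y [d2 [yb]]]]]].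
case/(dvdn_pfactor _ _ r_pr)=> z zc -> -> -> prim.
have tau_gt0 s e : prime s -> 0 < s ^ e by move=> s_pr; rewrite expn_gt0 prime_gt0.
case: (abcP x y z) => // [|x0|y0|z0|-> -> ->]; last by rewrite mulnA.
- rewrite lt0n; apply/eqP=> xyz0; apply: not_covering_number1.
  by case: prim; have [-> -> ->] : [/\ x = 0, y = 0 & z = 0] by split; lia.
- rewrite -(tau2 _ _ q_pr r_pr qr); apply: primitive_tau x0 prim; rewrite ?muln_gt0 ?tau_gt0 //.
  by rewrite -[p]expn1 coprimeMr !coprime_ltn_primes.
- rewrite -(tau2 _ _ p_pr r_pr pr); rewrite mulnCA in prim.
  apply: primitive_tau y0 prim; rewrite ?muln_gt0 ?tau_gt0 //.
  by rewrite -[q]expn1 coprimeMr coprime_sym !coprime_ltn_primes.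
rewrite -(tau2 _ _ p_pr q_pr pq); rewrite mulnA mulnC in prim.
apply: primitive_tau z0 prim; rewrite ?muln_gt0 ?tau_gt0 //.
by rewrite -[r]expn1 coprime_sym coprime3.
Qed.

Lemma primitive_of_exponents4 p q r s a b c e :
  prime p -> prime q -> prime r -> prime s -> p < q -> q < r -> r < s ->
  covering_number (p ^ a * q ^ b * r ^ c * s ^ e) ->
  (forall x y z t, x <= a -> y <= b -> z <= c -> t <= e -> 0 < x + y + z + t ->
     (0 < x -> p <= y.+1 * z.+1 * t.+1) -> (0 < y -> q <= x.+1 * z.+1 * t.+1) ->
     (0 < z -> r <= x.+1 * y.+1 * t.+1) -> (0 < t -> s <= x.+1 * y.+1 * z.+1) ->
     [/\ x = a, y = b, z = c & t = e]) ->
  primitive_covering_number (p ^ a * q ^ b * r ^ c * s ^ e).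
Proof.
move=> p_pr q_pr r_pr s_pr pq qr rs cov abceP.
have pr := ltn_trans pq qr; have qs := ltn_trans qr rs; have ps := ltn_trans pq qs.
apply: primitive_of_divisors cov _ => d; rewrite -!mulnA.
case/(dvdn_pfactorM p_pr)=> x [d1 [xa /(dvdn_pfactorM q_pr)[y [d2 [yb]]]]].
case/(dvdn_pfactorM r_pr)=> z [d3 [zc /(dvdn_pfactor _ _ s_pr)[t te ->]]] -> -> -> prim.
have tau_gt0 u v : prime u -> 0 < u ^ v by move=> u_pr; rewrite expn_gt0 prime_gt0.
case: (abceP x y z t) => // [|x0|y0|z0|t0|-> -> -> ->]; last by rewrite !mulnA.
- rewrite lt0n; apply/eqP=> xyz0; apply: not_covering_number1.
  case: prim; have [-> -> -> ->] : [/\ x = 0, y = 0, z = 0 & t = 0] by split; lia.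
  by [].
- rewrite -(tau3 _ _ _ q_pr r_pr s_pr qr rs) -mulnA.
  apply: primitive_tau x0 prim; rewrite ?muln_gt0 ?tau_gt0 //.
  by rewrite -[p]expn1 !coprimeMr !coprime_ltn_primes.
- rewrite -(tau3 _ _ _ p_pr r_pr s_pr pr rs) -mulnA; rewrite mulnCA in prim.
  apply: primitive_tau y0 prim; rewrite ?muln_gt0 ?tau_gt0 //.
  by rewrite -[q]expn1 !coprimeMr coprime_sym !coprime_ltn_primes.
- rewrite -(tau3 _ _ _ p_pr q_pr s_pr pq qs).
  have E : p ^ x * (q ^ y * (r ^ z * s ^ t)) = r ^ z * (p ^ x * q ^ y * s ^ t) by lia.
  rewrite E in prim; apply: primitive_tau z0 prim; rewrite ?muln_gt0 ?tau_gt0 //.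
  rewrite -[r]expn1 !coprimeMr !(coprime_sym _ (p ^ _)) !(coprime_sym _ (q ^ _)).
  by rewrite !coprime_ltn_primes.
rewrite -(tau3 _ _ _ p_pr q_pr r_pr pq qr); rewrite !mulnA mulnC in prim.
apply: primitive_tau t0 prim; rewrite ?muln_gt0 ?tau_gt0 //.
by rewrite -[s]expn1 !coprimeMr !(coprime_sym (s ^ 1) _) !coprime_ltn_primes.
Qed.

(** * Covers with moduli built from 2 and at most three odd primes *)

Lemma covers_nonmultiples_exp2 a : covers_nonmultiples (2 ^ a).
Proof.
by rewrite -[2 ^ a]mul1n; apply: covers_nonmultiples_pfactor covers_nonmultiples1.
Qed.

(** Since [tau (2 ^ a) = a.+1], the condition [q.-1 <= tau (2 ^ a)] takes the form [q <= a.+2]. *)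
Lemma covers_nonmultiples_exp2q q a b : prime q -> 2 < q -> q <= a.+2 ->
  covers_nonmultiples (2 ^ a * q ^ b).
Proof.
move=> q_pr q_gt2 le_q; apply: covers_nonmultiples_pfactor (covers_nonmultiples_exp2 a) => //.
- by rewrite expn_gt0.
- by rewrite -[q]expn1 coprime_sym coprime_ltn_primes.
by rewrite tau_pfactor //; lia.
Qed.

Lemma covering_number2 q a : prime q -> 2 < q -> q <= a.+1 -> covering_number (2 ^ a * q).
Proof.
move=> q_pr q_gt2 le_q; apply: covering_number_last_prime (covers_nonmultiples_exp2 a) => //.
- by rewrite expn_gt0.
- by rewrite -[q]expn1 coprime_sym coprime_ltn_primes.
by rewrite tau_pfactor.
Qed.

Lemma covering_number3 q r a b : prime q -> prime r -> 2 < q -> q < r ->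
  q <= a.+2 -> r <= a.+1 * b.+1 -> covering_number (2 ^ a * q ^ b * r ^ 1).
Proof.
move=> q_pr r_pr q_gt2 qr le_q le_r.
apply: covering_number_last_prime (covers_nonmultiples_exp2q b q_pr q_gt2 le_q) => //.
- by rewrite muln_gt0 !expn_gt0 (prime_gt0 q_pr).
- by rewrite coprime_sym coprime3.
by rewrite tau2.
Qed.

Lemma covering_number4 q r s a b c : prime q -> prime r -> prime s ->
  2 < q -> q < r -> r < s -> q <= a.+2 -> r.-1 <= a.+1 * b.+1 ->
  s <= a.+1 * b.+1 * c.+1 -> covering_number (2 ^ a * q ^ b * r ^ c * s ^ 1).
Proof.
move=> q_pr r_pr s_pr q_gt2 qr rs le_q le_r le_s.
have gt0 : 0 < 2 ^ a * q ^ b by rewrite muln_gt0 !expn_gt0 (prime_gt0 q_pr).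
have cov : covers_nonmultiples (2 ^ a * q ^ b * r ^ c).
  apply: covers_nonmultiples_pfactor (covers_nonmultiples_exp2q b q_pr q_gt2 le_q) => //.
    by rewrite -[r]expn1 coprime_sym coprime3.
  by rewrite tau2.
apply: covering_number_last_prime cov => //.
- by rewrite muln_gt0 gt0 expn_gt0 (prime_gt0 r_pr).
- rewrite coprime_sym coprimeMl coprime3 ?(ltn_trans qr) //=.
  by rewrite coprime_ltn_primes.
by rewrite tau3.
Qed.

(** * The two characterizations and the explicit families *)

Lemma primitive_dvd_eq n d : primitive_covering_number n -> d %| n ->
  covering_number d -> d = n.
Proof.
move=> [[n_gt0 _] prim] dn cov_d; apply/eqP; rewrite eqn_leq dvdn_leq //= leqNgt.
by apply/negP=> lt_dn; apply: prim cov_d.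
Qed.

Lemma prod_primes_logn n : 0 < n -> n = \prod_(p <- primes n) p ^ logn p n.
Proof. by move=> n_gt0; rewrite {1}(prod_prime_decomp n_gt0) prime_decompE big_map. Qed.

(** Once 2 is known to divide [n], the bound on the odd prime [q] makes [2 ^ (q - 1) * q] a covering
    divisor of [n]; by minimality it is [n]. *)
Lemma primitive_two_primes n : 1 < n -> size (primes n) <= 2 ->
  primitive_covering_number n ->
  exists p, [/\ prime p, odd p & n = 2 ^ (p - 1) * p].
Proof.
move=> n_gt1 le2 prim; have n_gt0 := ltnW n_gt1.
have log_gt0 p : p \in primes n -> prime p /\ 0 < logn p n.
  by move=> pn; rewrite logn_gt0; split=> //; move: pn; rewrite mem_primes => /andP[].
have := prod_primes_logn n_gt0; have := sorted_primes n.
move: log_gt0 le2; case: (primes n) => [|p [|q []]] //= log_gt0 _.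
- by rewrite big_nil; lia.
- rewrite big_seq1 => _ nE; have [p_pr lp_gt0] := log_gt0 p (mem_head _ _).
  have : p <= tau 1.
    by apply: (@primitive_tau p (logn p n)); rewrite ?coprimen1 ?muln1 -?nE.
  by have := prime_gt1 p_pr; rewrite /tau /=; lia.
rewrite andbT big_cons big_seq1 => lt_pq nE.
have [p_pr lp_gt0] := log_gt0 p (mem_head _ _).
have [q_pr lq_gt0] : prime q /\ 0 < logn q n by apply: log_gt0; rewrite !inE eqxx orbT.
have p2 : p = 2.
  have [//|odd_p] := even_prime p_pr.
  (* An auxiliary prime with exponent 0 completes the triple of odd primes. *)
  have [r lt_qr r_pr] := prime_above q.
  case: (@three_odd_primes_not_covering p q r (logn p n) (logn q n) 0) => //.
    by rewrite ltn_neqAle prime_gt1 // andbT; apply: contraTneq odd_p => <-.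
  by rewrite muln1 -nE; case: prim.
rewrite p2 in nE lt_pq; set a := logn 2 n in nE.
have le_q : q <= a.+1.
  rewrite -(tau_pfactor a (isT : prime 2)).
  apply: (@primitive_tau q (logn q n)); rewrite ?expn_gt0 ?(mulnC (q ^ _)) -?nE //.
  by rewrite -[q]expn1 coprime_sym coprime_ltn_primes.
have odd_q : odd q by case: (even_prime q_pr) lt_pq => [->|].
exists q; split=> //; apply/esym/(primitive_dvd_eq prim).
  rewrite nE dvdn_mul ?dvdn_exp2l //; first by lia.
  by rewrite -{1}[q]expn1 dvdn_exp2l.
by apply: covering_number2 => //; lia.
Qed.

Lemma primitive_2q q : prime q -> odd q -> primitive_covering_number (2 ^ (q - 1) * q).
Proof.
move=> q_pr odd_q; have q_gt2 : 2 < q.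
  by rewrite ltn_neqAle prime_gt1 // andbT; apply: contraTneq odd_q => <-.
have [r lt_qr r_pr] := prime_above q.
have E : 2 ^ (q - 1) * q = 2 ^ (q - 1) * q ^ 1 * r ^ 0 by rewrite muln1.
rewrite E; apply: primitive_of_exponents3 => //.
  by rewrite -E; apply: covering_number2 => //; lia.
move=> x y z le_x le_y; rewrite leqn0 => /eqP-> xy_gt0 x0 y0 _.
by case: x y x0 y0 le_x le_y xy_gt0 => [|x] [|[|y]] //; split; lia.
Qed.

(** The smallest prime is 2, so the next is 3, and the exponent of 2 is 1 because 12 is already a
    covering number. The bound on the largest prime then yields a covering divisor, equal to [n] by
    minimality. *)
Lemma primitive_three_primes n : 0 < n -> n = 0 %[mod 3] -> size (primes n) = 3 ->
  primitive_covering_number n ->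
  exists p, [/\ prime p, 3 < p & n = 2 * 3 ^ ((p - 1) %/ 2) * p].
Proof.
move=> n_gt0 n3 size3 prim.
have mem3 : 3 \in primes n by rewrite mem_primes n_gt0 /= /dvdn n3 mod0n.
have log_gt0 p : p \in primes n -> prime p /\ 0 < logn p n.
  by move=> pn; rewrite logn_gt0; split=> //; move: pn; rewrite mem_primes => /andP[].
have := prod_primes_logn n_gt0; have := sorted_primes n.
move: log_gt0 size3 mem3; case: (primes n) => [|p [|q [|r []]]] //= log_gt0 _ mem3.
rewrite andbT !big_cons big_nil muln1 => /andP[lt_pq lt_qr] nE.
have [p_pr lp_gt0] := log_gt0 p (mem_head _ _).
have [q_pr lq_gt0] : prime q /\ 0 < logn q n by apply: log_gt0; rewrite !inE eqxx orbT.
have [r_pr lr_gt0] : prime r /\ 0 < logn r n by apply: log_gt0; rewrite !inE eqxx !orbT.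
have p2 : p = 2.
  have [//|odd_p] := even_prime p_pr.
  case: (@three_odd_primes_not_covering p q r (logn p n) (logn q n) (logn r n)) => //.
    by rewrite ltn_neqAle prime_gt1 // andbT; apply: contraTneq odd_p => <-.
  by rewrite -nE; case: prim.
have q3 : q = 3 by move: mem3; rewrite !inE; have := prime_gt1 p_pr; lia.
rewrite {p p_pr log_gt0 mem3}p2 in lt_pq lp_gt0 nE.
rewrite {q lt_pq q_pr}q3 in lt_qr nE lq_gt0.
set a := logn 2 n in nE; set b := logn 3 n in nE lq_gt0; set c := logn r n in nE lr_gt0.
have a1 : a = 1.
  apply/eqP; rewrite eqn_leq lp_gt0 andbT leqNgt; apply/negP=> a_gt1.
  have r_gt1 := prime_gt1 r_pr.
  have cov12 : covering_number (2 ^ 2 * 3) by apply: covering_number2.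
  have dvd12 : 2 ^ 2 * 3 ^ 1 %| n.
    by rewrite nE mulnA dvdn_mulr // dvdn_mul ?dvdn_exp2l.
  have E := primitive_dvd_eq prim dvd12 cov12.
  have : r \in primes (2 ^ 2 * 3 ^ 1) by rewrite E -logn_gt0.
  rewrite mem_primes => /and3P[_ _].
  by rewrite Euclid_dvdM // !Euclid_dvdX // !dvdn_prime2 //; lia.
have le_r : r <= 2 * b.+1.
  rewrite -[2]/(1.+1) -(tau2 1 b (isT : prime 2) (isT : prime 3)) //.
  apply: (@primitive_tau r c); rewrite ?muln_gt0 ?expn_gt0 //.
    by rewrite -[r]expn1 coprime_sym coprime3.
  by rewrite mulnC -mulnA; rewrite nE a1 in prim.
have odd_r : odd r by case: (even_prime r_pr) lt_qr => [->|].
have E : 2 * 3 ^ ((r - 1) %/ 2) * r = 2 ^ 1 * 3 ^ ((r - 1) %/ 2) * r ^ 1 by [].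
exists r; split=> //; apply/esym/(primitive_dvd_eq prim); rewrite E.
  by rewrite nE a1 mulnA !dvdn_mul ?dvdn_exp2l //; lia.
by apply: covering_number3 => //; lia.
Qed.

Lemma primitive_2_3_p p : prime p -> 3 < p ->
  primitive_covering_number (2 * 3 ^ ((p - 1) %/ 2) * p).
Proof.
move=> p_pr p_gt3; have odd_p : odd p by case: (even_prime p_pr) p_gt3 => [->|].
rewrite -[2 * _]/(2 ^ 1 * _) -{2}[p]expn1.
apply: primitive_of_exponents3 => //; first by apply: covering_number3 => //; lia.
(* If [z = 0], the bounds for 3 and then for 2 force [y = x = 0]. If [z = 1], the bound for [p]
   forces [x = 1] and the largest [y]. *)
move=> [|[|x]] y [|[|z]] //= _ yb _ xyz x0 y0 z0; split=> //; try lia.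
Qed.

(** As tau(2^3) = 4 = 5 - 1, the powers of 5 can be absorbed, and [4 * ((p - 1) %/ 4 + 1)] moduli
    suffice for [p]. The other families use tau(6) = 4 and tau(18) = tau(2^5) = 6 = 7 - 1 in the
    same way. *)
Lemma primitive_8_5_p p : prime p -> 5 < p ->
  primitive_covering_number (2 ^ 3 * 5 ^ ((p - 1) %/ 4) * p).
Proof.
move=> p_pr p_gt5.
have np k : ~~ prime k -> p <> k by move=> nk pk; rewrite -pk p_pr in nk.
(* Exponent 2 for the prime 2 passes the bounds only for [p = 6] and [p = 9]. *)
have [np6 np9] : p <> 6 /\ p <> 9 by split; apply: np.
rewrite -{2}[p]expn1.
apply: primitive_of_exponents3 => //; first by apply: covering_number3 => //; lia.
by move=> [|[|[|[|x]]]] y [|[|z]] //= _ yb _ xyz x0 y0 z0; split=> //; lia.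
Qed.

Lemma primitive_6_5_p p : prime p -> 5 < p ->
  primitive_covering_number (2 * 3 * 5 ^ ((p - 1) %/ 4) * p).
Proof.
move=> p_pr p_gt5.
rewrite -[2 * 3]/(2 ^ 1 * 3 ^ 1) -{2}[p]expn1.
apply: primitive_of_exponents4 => //; first by apply: covering_number4 => //; lia.
by move=> [|[|x]] [|[|y]] z [|[|t]] //= _ _ zc _ xyzt x0 y0 z0 t0; split=> //; lia.
Qed.

Lemma primitive_18_7_p p : prime p -> 7 < p ->
  primitive_covering_number (2 * 3 ^ 2 * 7 ^ ((p - 1) %/ 6) * p).
Proof.
move=> p_pr p_gt7.
have np k : ~~ prime k -> p <> k by move=> nk pk; rewrite -pk p_pr in nk.
(* Exponent 1 for both 2 and 3 passes the bounds only for [p = 8]. *)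
have np8 : p <> 8 by apply: np.
rewrite -[2 * 3 ^ 2]/(2 ^ 1 * 3 ^ 2) -{2}[p]expn1.
apply: primitive_of_exponents4 => //; first by apply: covering_number4 => //; lia.
by move=> [|[|x]] [|[|[|y]]] z [|[|t]] //= _ _ zc _ xyzt x0 y0 z0 t0; split=> //; lia.
Qed.

Lemma primitive_32_7_p p : prime p -> 7 < p -> p <> 13 -> p <> 19 ->
  primitive_covering_number (2 ^ 5 * 7 ^ ((p - 1) %/ 6) * p).
Proof.
move=> p_pr p_gt7 p13 p19.
have np k : ~~ prime k -> p <> k by move=> nk pk; rewrite -pk p_pr in nk.
(* Exponents 3 and 4 for the prime 2 pass the bounds only for 8, 9, 10, 13, 14, 15, 19, 20 and 25;
   the primes among these are the excluded 13 and 19. *)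
have [np8 np9 np10] : [/\ p <> 8, p <> 9 & p <> 10] by split; apply: np.
have [np14 np15 np20 np25] : [/\ p <> 14, p <> 15, p <> 20 & p <> 25] by split; apply: np.
rewrite -{2}[p]expn1.
apply: primitive_of_exponents3 => //; first by apply: covering_number3 => //; lia.
by move=> [|[|[|[|[|[|x]]]]]] y [|[|z]] //= _ yb _ xyz x0 y0 z0; split=> //; lia.
Qed.

Theorem theorem1p4 :
  (forall n : nat, 1 < n -> size (primes n) <= 2 ->
     (primitive_covering_number n <->
      exists p : nat, [/\ prime p, odd p & n = 2 ^ (p - 1) * p]))
  /\
  (forall n : nat, 0 < n -> n = 0 %[mod 3] -> size (primes n) = 3 ->
     (primitive_covering_number n <->
      exists p : nat, [/\ prime p, 3 < p & n = 2 * 3 ^ ((p - 1) %/ 2) * p]))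
  /\
  ((forall p : nat, prime p -> 5 < p ->
      primitive_covering_number (2 ^ 3 * 5 ^ ((p - 1) %/ 4) * p) /\
      primitive_covering_number (2 * 3 * 5 ^ ((p - 1) %/ 4) * p))
   /\
   (forall p : nat, prime p -> 7 < p ->
      primitive_covering_number (2 * 3 ^ 2 * 7 ^ ((p - 1) %/ 6) * p) /\
      (p <> 13 -> p <> 19 ->
       primitive_covering_number (2 ^ 5 * 7 ^ ((p - 1) %/ 6) * p)))).
Proof.
split=> [n n_gt1 le2|].
  by split=> [|[p [p_pr odd_p ->]]]; [apply: primitive_two_primes | apply: primitive_2q].
split=> [n n_gt0 n3 size3|].
  by split=> [|[p [p_pr p_gt3 ->]]]; [apply: primitive_three_primes | apply: primitive_2_3_p].
split=> p p_pr p_gt; split.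
- exact: primitive_8_5_p.
- exact: primitive_6_5_p.
- exact: primitive_18_7_p.
exact: primitive_32_7_p.
Qed.
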